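(* There are exactly 13 pairs $(Q,\alpha)$ (up to isomorphism and reorientation of arrows), where $Q$ is a star-shaped quiver and $\alpha\in\mathcal{F}(Q)$ is a dimension vector in the fundamental region with all entries positive, such that $p(\alpha)=2$. Writing $[n;(a_1,a_2,\dots),(b_1,\dots),\dots]$ for the vector with entry $n$ at the central vertex and entries $a_1,a_2,\dots$ along a leg moving away from the central vertex, etc., they are: 1. $[2;(1),(1),(1),(1),(1)]$ 2. $[3;(1),(1),(2,1),(2,1)]$ 3. $[4;(1),(2),(2),(3,2,1)]$ 4. $[4;(2,1),(3,2,1),(3,2,1)]$ 5. $[4;(2),(2),(2),(2,1)]$ 6. $[5;(2),(4,3,2,1),(4,3,2,1)]$ 7. $[5;(3,1),(3,1),(4,3,2,1)]$ 8. $[6;(3),(4,2,1),(5,4,3,2,1)]$ 9. $[6;(4,2),(4,2),(4,2,1)]$ 10. $[8;(4),(5,2),(7,6,5,4,3,2,1)]$ 11. $[8;(4),(6,4,2),(6,4,2,1)]$ 12. $[10;(5),(7,4,1),(8,6,4,2)]$ 13. $[12;(6),(8,4),(10,8,6,4,2,1)]$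
   Context: A star-shaped quiver is a quiver with a central vertex $v$ whose arrows consist of finitely many legs (linear chains) attached to $v$, with no loops. For a quiver $Q$ with vertices $Q_0$ and arrows $Q_1$ ($h(a),t(a)$ head and tail), $\langle\alpha,\beta\rangle=\sum_{i\in Q_0}\alpha_i\beta_i-\sum_{a\in Q_1}\alpha_{t(a)}\beta_{h(a)}$, $(\alpha,\beta)=\langle\alpha,\beta\rangle+\langle\beta,\alpha\rangle$, and $p(\alpha)=1-\langle\alpha,\alpha\rangle$. The fundamental region $\mathcal{F}(Q)$ is the set of nonzero $\alpha\in\mathbb{N}^{Q_0}$ with connected support and $(\alpha,e_i)\le0$ for all coordinate vectors $e_i$. *)

(* Defs.v *)
From mathcomp Require Import all_boot all_order all_algebra.

Set Implicit Arguments.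
Unset Strict Implicit.
Unset Printing Implicit Defensive.

Import Order.TTheory GRing.Theory Num.Theory.
Local Open Scope ring_scope.

Record quiver := Quiver {
  vertex :> finType;
  arrow : finType;
  ahead : arrow -> vertex;
  atail : arrow -> vertex }.

Definition dimvec (Q : quiver) := Q -> nat.

Definition euler_form (Q : quiver) (alpha beta : Q -> int) : int :=
  \sum_(i : Q) alpha i * beta i -
  \sum_(a : arrow Q) alpha (atail a) * beta (ahead a).

Definition sym_form (Q : quiver) (alpha beta : Q -> int) : int :=
  euler_form alpha beta + euler_form beta alpha.

Definition intvec (Q : quiver) (alpha : dimvec Q) : Q -> int :=
  fun i => (alpha i)%:Z.

Definition coordvec (Q : quiver) (i : Q) : Q -> int :=
  fun j => if j == i then 1 else 0.

Definition pfun (Q : quiver) (alpha : dimvec Q) : int :=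
  1 - euler_form (intvec alpha) (intvec alpha).

Definition supp (Q : quiver) (alpha : dimvec Q) : {set Q} :=
  [set i | alpha i != 0%N].

Definition supp_adj (Q : quiver) (alpha : dimvec Q) : rel Q :=
  fun i j => [&& i \in supp alpha, j \in supp alpha &
    [exists a : arrow Q, [set ahead a; atail a] == [set i; j]]].

Definition connected_support (Q : quiver) (alpha : dimvec Q) : Prop :=
  {in supp alpha &, forall i j, connect (supp_adj alpha) i j}.

Definition fundamental_region (Q : quiver) (alpha : dimvec Q) : Prop :=
  [/\ exists i : Q, alpha i != 0%N,
      connected_support alpha
    & forall i : Q, sym_form (intvec alpha) (coordvec i) <= 0].

(* The legs list their vertices moving away from the central vertex [v]; the
   second condition says that the arrows, forgetting their orientations but
   counting multiplicities, are exactly the edges of the chains [v :: l].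
   Since the vertices are listed without repetition, there are no loops. *)
Definition star_shaped (Q : quiver) : Prop :=
  exists (v : Q) (legs : seq (seq Q)),
    perm_eq (v :: flatten legs) (enum Q) /\
    perm_eq [seq [set ahead a; atail a] | a <- enum (arrow Q)]
      (flatten [seq pairmap (fun x y => [set x; y]) v l | l <- legs]).

(* Isomorphism of pairs (Q, alpha) up to reorientation of arrows. *)
Definition iso_reorient (Q Q' : quiver) (alpha : dimvec Q)
    (alpha' : dimvec Q') : Prop :=
  exists (f : Q -> Q') (g : arrow Q -> arrow Q'),
    [/\ bijective f, bijective g,
        forall a, (ahead (g a) = f (ahead a) /\ atail (g a) = f (atail a)) \/
                  (ahead (g a) = f (atail a) /\ atail (g a) = f (ahead a))
      & forall i, alpha' (f i) = alpha i].

(* [(n, L)] encodes the symbol [n; L_0, L_1, ...]. *)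
Definition star_symbol := (nat * seq (seq nat))%type.

(* The vertex [Tagged _ j] over [i] is the [j]-th vertex of the [i]-th leg,
   counting from 0 at the vertex adjacent to the centre. *)
Definition leg_vertex (s : star_symbol) : finType :=
  {i : 'I_(size s.2) & 'I_(size (nth [::] s.2 i))}.

Definition ord_down (n : nat) (j : 'I_n) : 'I_n :=
  Ordinal (leq_ltn_trans (leq_pred j) (ltn_ord j)).

(* [None] is the centre. *)
Definition leg_prev (s : star_symbol) (x : leg_vertex s) :
    option (leg_vertex s) :=
  if (tagged x : nat) == 0%N then None
  else Some (Tagged (fun i : 'I_(size s.2) => 'I_(size (nth [::] s.2 i)))
               (ord_down (tagged x))).

(* Each leg vertex is the tail of one arrow, pointing towards the centre. *)
Definition star_quiver (s : star_symbol) : quiver :=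
  @Quiver (option (leg_vertex s)) (leg_vertex s) (@leg_prev s)
    (fun x => Some x).

Definition star_dimvec (s : star_symbol) : dimvec (star_quiver s) :=
  fun x => if x is Some y then nth 0%N (nth [::] s.2 (tag y)) (tagged y)
           else s.1.
Arguments star_dimvec : clear implicits.

Definition p2_star (Q : quiver) (alpha : dimvec Q) : Prop :=
  [/\ star_shaped Q, fundamental_region alpha,
      forall i : Q, (0 < alpha i)%N
    & pfun alpha = 2].

Definition star_table : 13.-tuple star_symbol :=
  [tuple
    (2,  [:: [:: 1]; [:: 1]; [:: 1]; [:: 1]; [:: 1]]);
    (3,  [:: [:: 1]; [:: 1]; [:: 2; 1]; [:: 2; 1]]);
    (4,  [:: [:: 1]; [:: 2]; [:: 2]; [:: 3; 2; 1]]);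
    (4,  [:: [:: 2; 1]; [:: 3; 2; 1]; [:: 3; 2; 1]]);
    (4,  [:: [:: 2]; [:: 2]; [:: 2]; [:: 2; 1]]);
    (5,  [:: [:: 2]; [:: 4; 3; 2; 1]; [:: 4; 3; 2; 1]]);
    (5,  [:: [:: 3; 1]; [:: 3; 1]; [:: 4; 3; 2; 1]]);
    (6,  [:: [:: 3]; [:: 4; 2; 1]; [:: 5; 4; 3; 2; 1]]);
    (6,  [:: [:: 4; 2]; [:: 4; 2]; [:: 4; 2; 1]]);
    (8,  [:: [:: 4]; [:: 5; 2]; [:: 7; 6; 5; 4; 3; 2; 1]]);
    (8,  [:: [:: 4]; [:: 6; 4; 2]; [:: 6; 4; 2; 1]]);
    (10, [:: [:: 5]; [:: 7; 4; 1]; [:: 8; 6; 4; 2]]);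
    (12, [:: [:: 6]; [:: 8; 4]; [:: 10; 8; 6; 4; 2; 1]])]%N.

(* Main.v *)
Require Import Defs.
From mathcomp Require Import all_boot all_order all_algebra.
From mathcomp Require Import zify ring.

Set Implicit Arguments.
Unset Strict Implicit.
Unset Printing Implicit Defensive.
Import GRing.Theory Num.Theory.

(** By bilinearity, twice the Euler form of [alpha] with itself is the sum over
the vertices [i] of [alpha i] times the pairing of [alpha] with the i-th
coordinate vector. On the fundamental region all the pairings are nonpositive,
so [p(alpha) = 2] says that the nonnegative weights
[- alpha i * (alpha, e_i)] add up to exactly 2: almost every vertex has
pairing 0, and the exceptional ones have a tiny dimension.

On a star-shaped quiver write [n] for the central entry. Nonpositive pairings
make each leg, read from the centre outwards and followed by 0, a convex
sequence, which is an arithmetic progression wherever the pairing vanishes.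
Hence the legs of weight at most 2 are explicit (lemma [light_leg_ladder]):
read from its far end, such a leg is a short tail [T] prolonged by steps of a
fixed size [m]. A leg of weight 0 has empty tail, hence entries [n - m, n - 2 m, ...]
for a proper divisor [m] of [n]; there are just four nonempty tails, of weight
1 or 2. In all cases the first entry of the leg is [n - m].

At the centre the pairing is [2 n] minus the sum of the first entries. If all
legs have weight 0, the centre carries the whole weight, which forces [n = 2]
and five legs [(1)]. Otherwise the legs carry the whole weight, and the
vanishing of the central pairing reads: the numbers [n - m] over all legs add
up to [2 n]. Since [m <= n / 2] for the legs of weight 0, there are at most
three of these, and divisibility gives [n <= 18] (lemmas [two_divisors] and
[solution_bound]); dividing by [n] one recognizes an equation between unit
fractions, as in the classification of the extended Dynkin stars. What is left
is a finite enumeration ([bounded_search]), which finds the symbols of the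
table.

To pass between quivers and symbols, any star-shaped quiver with a dimension
vector is isomorphic, up to reorientation, to the model quiver of the symbol
read off its legs ([symbol_iso]), and the symmetrized form is invariant under
such isomorphisms ([sym_form_iso]). The entries of the table are told apart by
the multisets of their dimensions ([iso_perm_dims]). *)

(** * Lifting permutations of lists of values *)

(** Used to carry a rearrangement of the legs of a symbol back to the legs of the
quiver that it comes from. *)
Lemma perm_map_lift (T1 T2 : eqType) (f : T1 -> T2) (t : seq T2) (s : seq T1) :
  perm_eq t (map f s) -> exists2 s', perm_eq s' s & t = map f s'.
Proof.
elim: t s => [|y t IHt] s pts.
  by exists [::] => //; rewrite perm_sym; move/perm_size: pts; case: s.
have /mapP[x xs yE] : y \in map f s by rewrite -(perm_mem pts) mem_head.
have ps := perm_to_rem xs.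
have [s' ps' ->] : exists2 s', perm_eq s' (rem x s) & t = map f s'.
  apply: IHt; rewrite -(perm_cons y) {2}yE -map_cons.
  by apply: perm_trans pts _; apply: perm_map.
by exists (x :: s'); rewrite ?yE // (permPr ps) perm_cons.
Qed.

Lemma bij_of_perm_enum (A B : finType) (f : A -> B) :
  perm_eq (map f (enum A)) (enum B) -> bijective f.
Proof.
move=> pf; apply: inj_card_bij.
  by apply/injectiveP; rewrite /injectiveb /dinjectiveb (perm_uniq pf) enum_uniq.
by move/perm_size: pf; rewrite size_map -!cardE => ->.
Qed.

(** Two families with the same multiset of values are matched by a bijection of
their index types; this turns an equality of edge multisets into a bijection of
arrows. *)
Lemma bij_of_perm_map (A B : finType) (T : eqType) (eA : A -> T) (eB : B -> T) :
  perm_eq (map eA (enum A)) (map eB (enum B)) ->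
  exists2 g : A -> B, bijective g & forall a, eB (g a) = eA a.
Proof.
move=> /perm_map_lift[s' ps' eAB].
have szs' : size s' == #|A|.
  by rewrite cardE -(size_map eA) eAB size_map.
pose g : {ffun A -> B} := Finfun (Tuple szs').
have gs' : map g (enum A) = s' by rewrite -codomE codom_ffun FinfunK.
exists g; first by apply: bij_of_perm_enum; rewrite gs'.
move: eAB; rewrite -gs' -(map_comp eB) => /eq_in_map eAB a.
by rewrite eAB ?mem_enum.
Qed.

Lemma set2_eq (T : finType) (a b c d : T) :
  [set a; b] = [set c; d] -> (a = c /\ b = d) \/ (a = d /\ b = c).
Proof.
move=> e.
have /set2P ha : a \in [set c; d] by rewrite -e set21.
have /set2P hb : b \in [set c; d] by rewrite -e set22.
have /set2P hc : c \in [set a; b] by rewrite e set21.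
have /set2P hd : d \in [set a; b] by rewrite e set22.
by case: ha => ea; case: hb => eb; subst; intuition congruence.
Qed.

Lemma enum_option (T : finType) :
  enum {: option T} = None :: map Some (enum T).
Proof. by rewrite -[LHS]filter_predT !enumT [in LHS]unlock filter_predT. Qed.

(** * The symmetrized Euler form *)
Section Forms.
Local Open Scope ring_scope.

(** The contribution of an arrow is symmetric in its two ends, which is why
nothing here depends on the orientation. *)
Lemma sym_formE (Q : quiver) (x y : Q -> int) :
  sym_form x y = 2 * (\sum_i x i * y i) -
    \sum_(a : arrow Q) (x (atail a) * y (ahead a) + x (ahead a) * y (atail a)).
Proof.
rewrite /sym_form /euler_form big_split /=.
have -> : \sum_i y i * x i = \sum_i x i * y i.
  by apply: eq_bigr => i _; rewrite mulrC.
have -> : \sum_(a : arrow Q) y (atail a) * x (ahead a) =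
  \sum_(a : arrow Q) x (ahead a) * y (atail a).
  by apply: eq_bigr => i _; rewrite mulrC.
ring.
Qed.

Lemma sum_coordvec (Q : quiver) (x : Q -> int) (j : Q) :
  \sum_i x i * coordvec i j = x j.
Proof.
rewrite (bigD1 j) //= big1 /coordvec ?eqxx ?mulr1 ?addr0 // => i.
by rewrite eq_sym => /negPf->; rewrite mulr0.
Qed.

(** Bilinearity; with [y = x] it splits the quadratic form into the weights of
the individual vertices. *)
Lemma sum_sym_form_coordvec (Q : quiver) (x y : Q -> int) :
  \sum_i y i * sym_form x (coordvec i) = sym_form x y.
Proof.
under eq_bigr do rewrite sym_formE mulrBr mulrCA !mulr_sumr.
rewrite sumrB sym_formE mulr_sumr exchange_big [X in _ - X]exchange_big /=.
congr (_ - _); apply: eq_bigr => j _.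
  by rewrite -!mulr_sumr; under eq_bigr do rewrite mulrCA;
     rewrite -mulr_sumr sum_coordvec.
under eq_bigr do rewrite mulrDr mulrCA [X in _ + X]mulrCA.
by rewrite big_split /= -!mulr_sumr !sum_coordvec.
Qed.

Lemma pfun_sym_form (Q : quiver) (alpha : dimvec Q) :
  2 * (pfun alpha - 1) = - sym_form (intvec alpha) (intvec alpha).
Proof. by rewrite /pfun /sym_form; ring. Qed.

Lemma sym_form_iso (Q Q' : quiver) (f : Q -> Q') (g : arrow Q -> arrow Q')
    (x y : Q -> int) (x' y' : Q' -> int) :
    bijective f -> bijective g ->
    (forall a, (ahead (g a) = f (ahead a) /\ atail (g a) = f (atail a)) \/
               (ahead (g a) = f (atail a) /\ atail (g a) = f (ahead a))) ->
    (forall i, x' (f i) = x i) -> (forall i, y' (f i) = y i) ->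
  sym_form x' y' = sym_form x y.
Proof.
move=> bf bg fg xf yf; rewrite !sym_formE (reindex f) /=; last exact: onW_bij.
rewrite [X in _ - X](reindex g) /=; last exact: onW_bij.
congr (_ * _ - _); first by apply: eq_bigr => i _; rewrite xf yf.
by apply: eq_bigr => a _; case: (fg a) => -[-> ->]; rewrite !xf !yf // addrC.
Qed.

Lemma coordvec_inj (Q Q' : quiver) (f : Q -> Q') i j :
  injective f -> coordvec (f i) (f j) = coordvec i j.
Proof. by move=> injf; rewrite /coordvec (inj_eq injf). Qed.

End Forms.

(** * The symbol of a star-shaped quiver *)

Definition leg_index (s : star_symbol) (y : leg_vertex s) : nat := tag y.
Definition leg_depth (s : star_symbol) (y : leg_vertex s) : nat := tagged y.

Lemma enum_leg_vertex_map (T : Type) (s : star_symbol) (F : nat -> nat -> T) :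
  [seq F (leg_index y) (leg_depth y) | y <- enum (leg_vertex s)] =
  flatten [seq [seq F i j | j <- iota 0 (size (nth [::] s.2 i))]
          | i <- iota 0 (size s.2)].
Proof.
rewrite enumT unlock /= /tag_enum map_flatten -val_enum_ord -!map_comp.
congr flatten; apply: eq_map => i /=.
by rewrite -val_enum_ord -!map_comp.
Qed.

Definition symbol_of (Q : quiver) (alpha : dimvec Q) v (legs : seq (seq Q)) :
  star_symbol := (alpha v, map (map alpha) legs).

Definition star_place (Q : quiver) v (legs : seq (seq Q)) s
    (x : option (leg_vertex s)) : Q :=
  if x is Some y then nth v (nth [::] legs (leg_index y)) (leg_depth y) else v.

Lemma star_place_prev (Q : quiver) v (legs : seq (seq Q)) s (y : leg_vertex s) :
  star_place v legs (leg_prev y) =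
  nth v (v :: nth [::] legs (leg_index y)) (leg_depth y).
Proof. by case: y => i [[|j] lt_j]. Qed.

(** A choice of centre and legs witnessing [star_shaped]; keeping it explicit
allows the legs to be reordered and the empty ones to be dropped. *)
Definition star_structure (Q : quiver) v (legs : seq (seq Q)) : Prop :=
    perm_eq (v :: flatten legs) (enum Q) /\
    perm_eq [seq [set ahead a; atail a] | a <- enum (arrow Q)]
      (flatten [seq pairmap (fun x y => [set x; y]) v l | l <- legs]).

(** The legs give a bijection [h] from the model quiver, as they list each vertex
once. Both edge multisets are images of the same chains under [h], so the
arrows can be matched so as to respect unordered pairs of ends. *)
Lemma symbol_iso (Q : quiver) (alpha : dimvec Q) v legs :
  star_structure v legs ->
  iso_reorient alpha (star_dimvec (symbol_of alpha v legs)).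
Proof.
set s := symbol_of _ _ _ => -[pV pE].
(* The index types of [leg_vertex s] involve sizes of lists of dimensions,
   while [h] reads vertices off [legs]. *)
pose h : star_quiver s -> Q := @star_place Q v legs s.
have sizeL i : size (nth [::] s.2 i) = size (nth [::] legs i).
  have [lt_i | ge_i] := ltnP i (size legs).
    by rewrite (nth_map [::]) // size_map.
  by rewrite !nth_default ?size_map.
have nthL i j : i < size legs -> j < size (nth [::] legs i) ->
    nth 0 (nth [::] s.2 i) j = alpha (nth v (nth [::] legs i) j).
  by move=> lt_i lt_j; rewrite (nth_map [::]) // (nth_map v).
have mapL (T : Type) (F : seq Q -> nat -> T) :
    [seq F (nth [::] legs (leg_index y)) (leg_depth y) | y <- enum (leg_vertex s)] =
    flatten [seq [seq F l j | j <- iota 0 (size l)] | l <- legs].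
  rewrite (enum_leg_vertex_map s (fun i => F (nth [::] legs i))) size_map.
  rewrite -[in RHS](mkseq_nth [::] legs) -map_comp.
  by congr flatten; apply: eq_map => i /=; rewrite sizeL.
have ph : perm_eq (map h (enum (star_quiver s))) (enum Q).
  rewrite (_ : enum _ = None :: map Some (enum (leg_vertex s))); last exact: enum_option.
  rewrite /= -map_comp.
  rewrite (_ : map _ _ = flatten legs) //.
  rewrite (mapL _ (nth v)) -[RHS](congr1 flatten (map_id legs)).
  congr flatten; apply: eq_map => l.
  exact: mkseq_nth.
have bh := bij_of_perm_enum ph; have [f hK fK] := bh.
have alphah x : star_dimvec s x = alpha (h x).
  case: x => [[i j]|] //=; rewrite /h /star_place /=.
  have lt_i : i < size legs by rewrite -(size_map (map alpha)).
  by apply: nthL => //; rewrite -sizeL.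
have pEs : perm_eq [seq [set ahead a; atail a] | a <- enum (arrow Q)]
   [seq [set h (leg_prev y); h (Some y)] | y <- enum (leg_vertex s)].
  rewrite (perm_trans pE) //.
  rewrite (_ : flatten _ =
    [seq [set h (leg_prev y); h (Some y)] | y <- enum (leg_vertex s)]) //.
  transitivity [seq [set nth v (v :: nth [::] legs (leg_index y)) (leg_depth y);
         nth v (nth [::] legs (leg_index y)) (leg_depth y)] | y <- enum (leg_vertex s)].
    rewrite (mapL _ (fun l j => [set nth v (v :: l) j; nth v l j])).
    congr flatten; apply: eq_map => l; apply: (@eq_from_nth _ set0).
      by rewrite size_pairmap size_map size_iota.
    move=> j; rewrite size_pairmap => lt_j.
    by rewrite (nth_pairmap v) // (nth_map 0) ?size_iota // nth_iota.
  by apply: eq_map => y; rewrite /h star_place_prev.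
have [g bg gE] := bij_of_perm_map pEs.
exists f, g; split=> //; first by exists h.
  move=> a; rewrite /= -[leg_prev _]hK -[Some _]hK.
  by case: (set2_eq (gE a)) => -[-> ->]; [left|right].
by move=> i; rewrite alphah fK.
Qed.

(** * Convexity and weight of a symbol *)

Fixpoint leg_convex (p : nat) (l : seq nat) : bool :=
  if l is a :: l' then (2 * a <= p + head 0 l') && leg_convex a l' else true.

(** The sum over the leg of [- alpha i * (alpha, e_i)], where [p] is the entry
before the first one; the truncated subtraction is exact on convex legs. *)
Fixpoint leg_weight (p : nat) (l : seq nat) : nat :=
  if l is a :: l' then a * (p + head 0 l' - 2 * a) + leg_weight a l' else 0.

Definition head_sum (s : star_symbol) : nat := sumn (map (head 0) s.2).

Definition star_convex (s : star_symbol) : bool :=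
  (2 * s.1 <= head_sum s) && all (leg_convex s.1) s.2.

Definition star_weight (s : star_symbol) : nat :=
  s.1 * (head_sum s - 2 * s.1) + sumn (map (leg_weight s.1) s.2).

Lemma leg_convexP p l :
  reflect (forall j, j < size l ->
             2 * nth 0 l j <= nth 0 (p :: l) j + nth 0 l j.+1)
          (leg_convex p l).
Proof.
elim: l p => [|a l IHl] p /=; first by constructor.
apply: (iffP andP) => [[h0 /IHl h] [|j] // lt_j | h].
- exact: h.
- split; first by rewrite -nth0; apply: (h 0).
  by apply/IHl => j lt_j; apply: (h j.+1).
Qed.

Lemma sum_leg_vertex (V : nmodType) (s : star_symbol) (F : nat -> nat -> V) :
  (\sum_(y : leg_vertex s) F (leg_index y) (leg_depth y) =
   \sum_(0 <= i < size s.2) \sum_(0 <= j < size (nth [::] s.2 i)) F i j)%R.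
Proof.
transitivity (\sum_(x <- [seq F (leg_index y) (leg_depth y)
                      | y <- enum (leg_vertex s)]) x)%R.
  by rewrite big_map big_enum.
rewrite enum_leg_vertex_map big_flatten big_map /index_iota subn0.
by apply: eq_bigr => i _; rewrite big_map subn0.
Qed.

Lemma sum_legs (V : nmodType) (s : star_symbol) (G : seq nat -> nat -> V) :
  (\sum_(y : leg_vertex s) G (nth [::] s.2 (leg_index y)) (leg_depth y) =
   \sum_(l <- s.2) \sum_(0 <= j < size l) G l j)%R.
Proof.
by rewrite (sum_leg_vertex s (fun i => G (nth [::] s.2 i))) [RHS](big_nth [::]).
Qed.

Lemma sum_option (V : nmodType) (T : finType) (F : option T -> V) :
  (\sum_x F x = F None + \sum_y F (Some y))%R.
Proof. by rewrite -big_enum enum_option big_cons big_map big_enum. Qed.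

Lemma leg_vertex_eq (s : star_symbol) (x y : leg_vertex s) :
  (x == y) = (leg_index x == leg_index y) && (leg_depth x == leg_depth y).
Proof.
case: x y => [i j] [i' j']; rewrite /leg_index /leg_depth /=.
apply/eqP/andP => [e|[/eqP/val_inj ii]].
  have := f_equal (fun z : leg_vertex s => (leg_index z, leg_depth z)) e.
  by case=> /eqP ? /eqP ?.
by case: i' / ii j' => j' /eqP/val_inj ->.
Qed.

Section StarForms.
Local Open Scope ring_scope.
Variable s : star_symbol.
Let alpha : star_quiver s -> int := intvec (star_dimvec s).

Lemma star_dimvec_prev (y : leg_vertex s) :
  alpha (leg_prev y) = (nth 0%N (s.1 :: nth [::] s.2 (leg_index y)) (leg_depth y))%:Z.
Proof. by case: y => i [[|j] lt_j]. Qed.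

Lemma star_sym_form_coordvec (k : star_quiver s) :
  sym_form alpha (coordvec k) = 2 * alpha k -
    (\sum_(y : leg_vertex s) alpha (leg_prev y) * coordvec k (Some y : star_quiver s) +
     \sum_(y : leg_vertex s) alpha (Some y) * coordvec k (leg_prev y : star_quiver s)).
Proof.
rewrite sym_formE big_split /= -[in RHS](sum_coordvec alpha k).
congr (_ * _ - _); last exact: addrC.
by apply: eq_bigr => i _; rewrite /coordvec eq_sym.
Qed.

Lemma star_sym_form_center :
  sym_form alpha (coordvec (None : star_quiver s)) =
  2 * s.1%:Z - (head_sum s)%:Z.
Proof.
rewrite star_sym_form_coordvec big1 ?add0r; last first.
  by move=> y _; rewrite /coordvec mulr0.
congr (_ - _).
transitivity (\sum_(y : leg_vertex s)
    (fun l j => (nth 0%N l j * (j == 0))%N%:Z) (nth [::] s.2 (leg_index y)) (leg_depth y)).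
  apply: eq_bigr => -[i [[|j] lt_j]] _; rewrite /coordvec /leg_prev /leg_depth /=.
    by rewrite mulr1 muln1.
  by rewrite mulr0 muln0.
rewrite (sum_legs s (fun l j => (nth 0%N l j * (j == 0))%N%:Z)) /head_sum.
rewrite /head_sum sumnE big_map (big_morph Posz PoszD erefl).
apply: eq_bigr => l _; case: l => [|a l] /=; first by rewrite big_nil.
rewrite big_nat_recl // big1 ?addr0 ?muln1 // => j _.
by rewrite muln0.
Qed.

Lemma star_sym_form_leg (x : leg_vertex s) :
  sym_form alpha (coordvec (Some x : star_quiver s)) =
  2 * (nth 0%N (nth [::] s.2 (leg_index x)) (leg_depth x))%:Z -
  ((nth 0%N (s.1 :: nth [::] s.2 (leg_index x)) (leg_depth x))%:Z +
   (nth 0%N (nth [::] s.2 (leg_index x)) (leg_depth x).+1)%:Z).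
Proof.
rewrite star_sym_form_coordvec; congr (_ - (_ + _)).
  rewrite (bigD1 x) //= big1 => [|y /negPf y_x]; rewrite /coordvec.
    by rewrite eqxx mulr1 addr0 star_dimvec_prev.
  by rewrite (inj_eq (@Some_inj _)) y_x mulr0.
set i := leg_index x; set j := leg_depth x.
pose G i' j' := ((nth 0%N (nth [::] s.2 i') j') * ((i' == i) && (j' == j.+1)))%N%:Z.
transitivity (\sum_(y : leg_vertex s) G (leg_index y) (leg_depth y)).
  apply: eq_bigr => y _; rewrite /G PoszM; congr (_ * _).
  case: y => i' [[|j'] lt_j']; rewrite /coordvec /leg_prev /=.
    by rewrite andbF.
  by rewrite (inj_eq (@Some_inj _)) leg_vertex_eq /leg_depth /= eqSS; case: ifP.
rewrite (sum_leg_vertex s G) (bigD1_seq i) ?iota_uniq ?mem_index_iota //=; last exact: ltn_ord.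
rewrite [X in _ + X]big1 ?addr0 => [|i' /negPf i'_i]; last first.
  by rewrite big1 // => j' _; rewrite /G i'_i muln0.
have [lt_j | ge_j] := ltnP j.+1 (size (nth [::] s.2 i)).
  rewrite (bigD1_seq j.+1) ?iota_uniq ?mem_index_iota //= [X in _ + X]big1.
    by rewrite addr0 /G !eqxx muln1.
  by move=> j' /negPf j'_j; rewrite /G j'_j andbF muln0.
rewrite [in RHS]nth_default // big_nat big1 // => j' lt_j'.
by rewrite /G (ltn_eqF (leq_trans _ ge_j)) ?andbF ?muln0.
Qed.

Lemma star_convexP :
  (forall i, sym_form alpha (coordvec i) <= 0) <-> star_convex s.
Proof.
split=> [h | /andP[h0 hl]].
  apply/andP; split.
    by have := h None; rewrite star_sym_form_center; lia.
  apply/(all_nthP [::]) => i lt_i; apply/leg_convexP => j lt_j.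
  pose x : leg_vertex s := existT _ (Ordinal lt_i) (Ordinal lt_j).
  by have := h (Some x); rewrite star_sym_form_leg /leg_index /leg_depth /=; lia.
case=> [x|]; last by rewrite star_sym_form_center; lia.
have lt_x : (leg_index x < size s.2)%N by exact: ltn_ord.
have /leg_convexP/(_ (leg_depth x)) := all_nthP [::] hl _ lt_x.
by rewrite star_sym_form_leg => /(_ (ltn_ord _)); lia.
Qed.

Lemma leg_weightE p l : leg_convex p l ->
  (leg_weight p l)%:Z =
  \sum_(0 <= j < size l) (nth 0%N l j)%:Z *
    ((nth 0%N (p :: l) j)%:Z + (nth 0%N l j.+1)%:Z - 2 * (nth 0%N l j)%:Z).
Proof.
elim: l p => [|a l IHl] p /=; first by rewrite big_nil.
case/andP=> h0 /IHl hl; rewrite big_nat_recl //= -hl nth0 PoszD PoszM.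
by congr (_ * _ + _); lia.
Qed.

(** The weights of the vertices add up to [- (alpha, alpha)]. *)
Lemma star_weightE : star_convex s ->
  2 * (pfun (star_dimvec s) - 1) = (star_weight s)%:Z.
Proof.
case/andP=> h0 hl; rewrite pfun_sym_form -sum_sym_form_coordvec sum_option.
rewrite star_sym_form_center opprD -sumrN /star_weight PoszD; congr (_ + _).
  by rewrite -mulrN PoszM /intvec /=; congr (_ * _); lia.
pose G l j := (nth 0%N l j)%:Z *
    ((nth 0%N (s.1 :: l) j)%:Z + (nth 0%N l j.+1)%:Z - 2 * (nth 0%N l j)%:Z).
transitivity (\sum_(y : leg_vertex s) G (nth [::] s.2 (leg_index y)) (leg_depth y)).
  apply: eq_bigr => y _; rewrite star_sym_form_leg /G /intvec /=; ring.
rewrite (sum_legs s G) sumnE big_map (big_morph Posz PoszD erefl).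
by rewrite !big_seq; apply: eq_bigr => l /(allP hl)/leg_weightE.
Qed.

End StarForms.

(** * Legs of weight at most two *)

(** The kind [(m, T)] describes the legs which end with the tail [T] and grow by
[m] at each step from there towards the centre. *)
Definition leg_kind := (nat * seq nat)%type.

Definition ladder (t : leg_kind) (k : nat) : seq nat :=
  iter k (fun l => head 0 l + t.1 :: l) t.2.

(** The kinds of positive weight: the tail starts at the only vertex of the leg
with nonzero pairing. *)
Definition heavy_kinds : seq leg_kind :=
  [:: (2, [:: 1]); (3, [:: 1]); (3, [:: 2]); (2, [:: 2; 1])].

Definition kind_weight (t : leg_kind) : nat := if t == (2, [:: 1]) then 1 else 2.

Definition light_kind (w : nat) (t : leg_kind) : bool :=
  if nilp t.2 then (w == 0) && (0 < t.1)
  else (w == kind_weight t) && (t \in heavy_kinds).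

Lemma head_ladder t k : head 0 (ladder t k) = head 0 t.2 + k * t.1.
Proof. by case: k => [|k]; rewrite ?addn0 //=; elim: k => [|k IHk] /=; lia. Qed.

(** Induction from the far end; [- d] is the pairing at the vertex [a]. If [d] is 0
the progression continues. Suppose [d] is not 0. If [l] has weight 0, then
[a * d <= 2] forces [a <= 2], so [a :: l] is [[:: 1]], [[:: 2]] or [[:: 2; 1]],
and these are the tails of the heavy kinds. Once a heavy tail has been passed,
[a] is at least 3, so no further weight fits. Including the centre [p] in the
ladder makes the statement inductive, and gives [[:: p]] as an empty tail
prolonged by one step of size [p]. *)
Lemma light_leg_ladder p l :
  all (leq 1) (p :: l) -> leg_convex p l -> leg_weight p l <= 2 ->
  exists t k, light_kind (leg_weight p l) t /\ p :: l = ladder t k.+1.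
Proof.
elim: l p => [|a l IHl] p /=.
  rewrite andbT => p_gt0 _ _; exists (p, [::]), 0.
  by rewrite /light_kind /= add0n.
case/and3P=> p_gt0 a_gt0 l_gt0 /andP[le2a cvx] wle.
have [||t [k [tP al]]] := IHl a _ cvx; first by rewrite /= a_gt0.
  exact: leq_trans (leq_addl _ _) wle.
have [aE lE] : a = head 0 t.2 + k.+1 * t.1 /\ l = ladder t k.
  by split; [rewrite -head_ladder -al|case: al].
have hE : head 0 l = head 0 t.2 + k * t.1 by rewrite lE head_ladder.
set d := p + head 0 l - 2 * a in wle *.
have [d0|d_gt0] := posnP d.
  exists t, k.+1; rewrite d0 muln0 add0n; split=> //.
  transitivity (head 0 (ladder t k.+1) + t.1 :: ladder t k.+1) => //.
  by rewrite -al /=; congr (_ :: _); rewrite mulSn in aE; lia.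
have ad_gt0 : 0 < a * d by rewrite muln_gt0 a_gt0.
move: tP; rewrite /light_kind; case: ifP => [/nilP t2 /andP[/eqP w0 t1]| _].
  rewrite w0 addn0 in wle *; rewrite t2 /= in aE hE.
  have kt : (t.1 = 1 /\ k = 0) \/ (t.1 = 2 /\ k = 0) \/ (t.1 = 1 /\ k = 1) by nia.
  have dE : d = p + k * t.1 - 2 * a by rewrite /d hE.
  clearbody d.
  case: kt => [[t1E k0]|[[t1E k0]|[t1E k1]]]; subst k.
  - have [d1|d2] : d = 1 \/ d = 2 by nia.
    + exists (2, [:: 1]), 0; rewrite lE /ladder t2 /=.
      have -> : a = 1 by lia.
      have -> : p = 3 by lia.
      by rewrite d1; split.
    + exists (3, [:: 1]), 0; rewrite lE /ladder t2 /=.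
      have -> : a = 1 by lia.
      have -> : p = 4 by lia.
      by rewrite d2; split.
  - exists (3, [:: 2]), 0; rewrite lE /ladder t2 /=.
    have -> : a = 2 by lia.
    have -> : d = 1 by nia.
    have -> : p = 5 by nia.
    by split.
  - exists (2, [:: 2; 1]), 0; rewrite lE /ladder t2 /= t1E.
    have -> : a = 2 by lia.
    have -> : d = 1 by nia.
    have -> : p = 4 by nia.
    by split.
case/andP=> /eqP wE tP; suff : a * d + leg_weight a l > 2 by rewrite ltnNge wle.
have : (leg_weight a l = 1 /\ head 0 t.2 + t.1 = 3) \/ leg_weight a l = 2.
  by rewrite wE; move: tP; rewrite !inE => /or4P[] /eqP->; [left|right|right|right].
by nia.
Qed.

(** * Enumeration of the symbols *)

(** The leg with central entry [n]; the centre is the last step of the ladder,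
whence the predecessor. *)
Definition leg_of n (t : leg_kind) : seq nat :=
  ladder t ((n - head 0 t.2) %/ t.1).-1.

Definition fits n (t : leg_kind) : bool :=
  (head 0 t.2 + t.1 <= n) && (t.1 %| n - head 0 t.2).

(** Whether a nonempty leg of kind [(m, [::])] can be attached to a centre of
dimension [n]. The bound says that the leg has at least one vertex. *)
Definition divisor_fits n m : bool := [&& 0 < m, 2 * m <= n & m %| n].

Definition legs_of n (sp : seq leg_kind) (ms : seq nat) : seq (seq nat) :=
  map (leg_of n) (sp ++ [seq (m, [::]) | m <- ms]).

Lemma light_leg_kind n l :
  0 < n -> all (leq 1) l -> l != [::] -> leg_convex n l -> leg_weight n l <= 2 ->
  exists2 t, l = leg_of n t /\ head 0 l = n - t.1 &
    [/\ leg_weight n l = 0, t.2 = [::] & divisor_fits n t.1] \/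
    [/\ leg_weight n l = kind_weight t, t \in heavy_kinds & fits n t].
Proof.
move=> n_gt0 l_gt0 l0 cvx wle.
have [|t [k [tP nl]]] := light_leg_ladder _ cvx wle; first by rewrite /= n_gt0.
have [nE lE] : n = head 0 t.2 + k.+1 * t.1 /\ l = ladder t k.
  by split; [rewrite -head_ladder -nl|case: nl].
have t1_gt0 : 0 < t.1.
  move: tP; rewrite /light_kind; case: ifP => _ /andP[_] //.
  by rewrite !inE => /or4P[] /eqP->.
exists t.
  split; last by rewrite lE head_ladder nE mulSn; lia.
  by rewrite lE /leg_of {1}nE addKn mulnK.
move: tP; rewrite /light_kind; case: ifP => [/nilP t2|_] /andP[/eqP-> tP]; [left|right].
  split=> //; move: nE; rewrite t2 add0n => nE.
  rewrite /divisor_fits t1_gt0 nE dvdn_mull // andbT.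
  by case: k lE {nl nE} => [|k] lE; [rewrite lE /ladder /= t2 in l0|nia].
by split=> //; rewrite /fits nE addKn dvdn_mull // mulSn addnA leq_addr.
Qed.

(** Sorts the legs into the list [sp] of those of positive weight and the list
[ms] of the divisors that give the others. *)
Lemma light_legs n L :
  0 < n -> all (leg_convex n) L -> all (all (leq 1)) L -> [::] \notin L ->
  sumn (map (leg_weight n) L) <= 2 ->
  exists sp ms, [/\ perm_eq L (legs_of n sp ms),
    sumn (map (head 0) L) =
      sumn [seq n - t.1 | t <- sp] + sumn [seq n - m | m <- ms],
    sumn (map (leg_weight n) L) = sumn (map kind_weight sp),
    {subset sp <= heavy_kinds} & all (fits n) sp && all (divisor_fits n) ms].
Proof.
move=> n_gt0; elim: L => [|l L IHL] /=; first by exists [::], [::].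
case/andP=> cl cL /andP[pl pL]; rewrite inE negb_or eq_sym => /andP[l0 L0] wle.
have [|sp [ms [LE hL wL spP okL]]] := IHL cL pL L0.
  exact: leq_trans (leq_addl _ _) wle.
have [|t [lE hl] kt] := light_leg_kind n_gt0 pl l0 cl.
  exact: leq_trans (leq_addr _ _) wle.
case: kt => [[-> t2 okt]|[wl tP okt]].
  exists sp, (t.1 :: ms); split=> //=.
  - rewrite /legs_of /= perm_sym map_cat /= -cat1s perm_catCA cat1s -map_cat perm_sym.
    by rewrite (_ : (t.1, [::]) = t) -?lE ?perm_cons //; case: (t) t2 => ? ? /= ->.
  - by rewrite hL hl addnCA.
  - by case/andP: okL => -> ->; rewrite okt.
exists (t :: sp), ms; split=> //=.
- by rewrite [l]lE; move: LE; rewrite -(perm_cons (leg_of n t)).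
- by rewrite hL hl addnA.
- by rewrite wL wl.
- by move=> x; rewrite inE => /predU1P[->|/spP].
- by rewrite okt.
Qed.

(** The possible kinds of the legs of positive weight, when there are any. A
single kind of weight 1 is kept among them, since the divisor equation
discards it. *)
Definition heavy_lists : seq (seq leg_kind) :=
  [:: (2, [:: 1]); (2, [:: 1])] :: [seq [:: t] | t <- heavy_kinds].

Lemma heavy_listP sp : {subset sp <= heavy_kinds} ->
  sumn (map kind_weight sp) <= 2 -> sp = [::] \/ sp \in heavy_lists.
Proof.
case: sp => [|t sp] spP; first by left.
have /spP tP := mem_head t sp.
have {}spP : {subset sp <= heavy_kinds} by move=> x xs; apply: spP; rewrite inE xs orbT.
have k1 x : 1 <= kind_weight x by rewrite /kind_weight; case: ifP.
move=> /= wle; right.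
case: sp spP wle => [|u sp] spP /=.
  by move=> _; move: tP; rewrite !inE => /or4P[] /eqP->.
move=> wle; have := k1 t; have := k1 u => k1u k1t.
case: sp spP wle => [|v sp] spP /=; last by have := k1 v; lia.
have {}k1 x : kind_weight x <= 1 -> x = (2, [:: 1]).
  by rewrite /kind_weight; case: eqP.
rewrite addn0 => wle; have [wt wu] : kind_weight t <= 1 /\ kind_weight u <= 1.
  by clear -wle k1t k1u; lia.
by rewrite (k1 t wt) (k1 u wu).
Qed.

(** With [a = n / i] and [b = n / j] this bounds the solutions of
[1/i + 1/j + d/n = 1]. If [i] and [j] are both at least 3 then [n <= 3 d].
Otherwise, say, [i = 2]; then [n = 2 (b + d)] and [b] divides [n], so [b]
divides [2 d]. *)
Lemma two_divisors a b d n :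
  divisor_fits n a -> divisor_fits n b -> 0 < d -> a + b + d = n -> n <= 6 * d.
Proof.
wlog le_ba : a b / b <= a => [wl fa fb d0 e|].
  case/orP: (leq_total b a) => le; first exact: wl fa fb d0 e.
  by apply: wl fb fa d0 _; rewrite // (addnC b).
case/and3P=> a0 _ /dvdnP[i nE] /and3P[b0 _ b_n] d0 e.
have [i3|] := leqP 3 i; first by nia.
case: i nE => [|[|[|]]] // nE _; try by nia.
have b2d : b %| 2 * d.
  by rewrite -(dvdn_addr _ (dvdn_mull 2 (dvdnn b))) -mulnDr (_ : 2 * (b + d) = n) //; lia.
by have := dvdn_leq _ b2d; lia.
Qed.

Fixpoint short_words (T : Type) (dom : seq T) (k : nat) : seq (seq T) :=
  if k is k'.+1 then
    [::] :: [seq x :: l | x <- dom, l <- short_words dom k'] else [:: [::]].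

Lemma mem_short_words (T : eqType) (dom : seq T) k l :
  size l <= k -> {subset l <= dom} -> l \in short_words dom k.
Proof.
elim: k l => [|k IHk] [|x l] //= szl ld; rewrite inE.
apply/orP; right; apply: allpairs_f; first by rewrite ld ?mem_head.
by apply: IHk => // y yl; rewrite ld // inE yl orbT.
Qed.

Definition in_star_table n L : bool :=
  has (fun s : star_symbol => (s.1 == n) && perm_eq s.2 L) star_table.

(** The divisors run through [1..9] because they are at most half of [n]. *)
Lemma bounded_search n sp ms :
  n <= 18 -> size ms <= 3 -> sp \in heavy_lists ->
  all (fits n) sp && all (divisor_fits n) ms ->
  sumn [seq n - t.1 | t <- sp] + sumn [seq n - m | m <- ms] = 2 * n ->
  in_star_table n (legs_of n sp ms).
Proof.
pose dom n := filter (divisor_fits n) (iota 1 9).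
pose ok n sp ms := all (fits n) sp &&
  (sumn [seq n - t.1 | t : leg_kind <- sp] + sumn [seq n - m | m <- ms] == 2 * n) ==>
  in_star_table n (legs_of n sp ms).
have chk : all (fun n => all (fun sp => all (ok n sp) (short_words (dom n) 3)) heavy_lists)
  (iota 0 19).
  by vm_compute.
move=> le_n sz_ms spP /andP[fsp fms] e.
have msP : ms \in short_words (dom n) 3.
  apply: (mem_short_words sz_ms) => m mms.
  have fm := allP fms m mms; rewrite mem_filter fm mem_iota.
  by case/and3P: fm; clear -le_n; lia.
have n19 : n \in iota 0 19 by rewrite mem_iota.
have /allP/(_ _ msP) := allP (allP chk n n19) sp spP.
by rewrite /ok fsp e eqxx.
Qed.

Lemma sum_codivisors n ms : all (divisor_fits n) ms ->
  size ms * n <= 2 * sumn [seq n - m | m <- ms].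
Proof.
elim: ms => //= m ms IHms /andP[/and3P[_ le_m _] /IHms].
by rewrite mulSn; lia.
Qed.

(** Two heavy legs of kind [(2, [:: 1])] leave 4 for the sum of the [n - m], each
at least [n / 2]. A single heavy leg of step [d] leaves [n + d]: one divisor
cannot reach this, two are bounded by [two_divisors], three give [n <= 2 d], and
four would exceed it because [d < n]. *)
Lemma solution_bound n sp ms : sp \in heavy_lists ->
  all (fits n) sp -> all (divisor_fits n) ms ->
  sumn [seq n - t.1 | t <- sp] + sumn [seq n - m | m <- ms] = 2 * n ->
  n <= 18 /\ size ms <= 3.
Proof.
move=> spP fsp fms e.
have bnd := sum_codivisors fms.
move: spP fsp e; rewrite inE => /predU1P[->|/mapP[t tP ->]] /=.
  rewrite /fits /= andbT => /andP[/andP[n3 _] _] e.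
  have {}e : sumn [seq n - m | m <- ms] = 4 by lia.
  have : 0 < size ms by case: (ms) e.
  by split; nia.
rewrite andbT addn0 => ft e.
have [d2 d3 ltd] : [/\ 2 <= t.1, t.1 <= 3 & t.1 < n].
  move: tP ft; rewrite !inE => /or4P[] /eqP-> /andP[/= ltn _];
    by split=> //; clear -ltn; lia.
move: (t.1) d2 d3 ltd e => d d2 d3 ltd e {t tP ft}.
have {}e : sumn [seq n - m | m <- ms] = n + d by lia.
split; last by rewrite leqNgt; apply/negP => sz4; nia.
case: ms fms e bnd => [|a [|b [|c [|x ms]]]] /=; try lia.
case/and3P=> fa fb _ e _; have := two_divisors fa fb (ltnW d2).
by move: fa fb; rewrite /divisor_fits; lia.
Qed.

(** If no leg has positive weight, the centre alone has weight 2; since [n] is at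
least 2 this means [n = 2], so every divisor is 1 and there are five legs. *)
Lemma classification n L :
  0 < n -> star_convex (n, L) -> all (all (leq 1)) L -> [::] \notin L ->
  star_weight (n, L) = 2 -> in_star_table n L.
Proof.
move=> n_gt0 /andP[le_h cvx] L_gt0 L0; rewrite /star_weight /= => wL.
have [|sp [ms [LE hL wE spP /andP[fsp fms]]]] := light_legs n_gt0 cvx L_gt0 L0.
  by rewrite -wL leq_addl.
have tableE : in_star_table n (legs_of n sp ms) -> in_star_table n L.
  case/hasP=> x xT /andP[x1 x2]; apply/hasP; exists x => //.
  by rewrite x1 (perm_trans x2) // perm_sym.
apply: tableE; rewrite /head_sum /= hL wE in le_h wL.
have [|sp0|spL] := heavy_listP spP; first by rewrite -wL leq_addl.
  rewrite {}sp0 /= add0n addn0 in le_h wL *.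
  have n2 : 1 < n.
    case: ms fms le_h {LE hL wL} => [|m ms] /=; first by lia.
    by case/andP=> /and3P[m_gt0 le_m _] _ _; lia.
  have [nE hE] : n = 2 /\ sumn [seq n - m | m <- ms] = 5 by nia.
  subst n; have ms1 : all (pred1 1) ms.
    apply: sub_all fms => m /and3P[m0 m2 _] /=.
    by rewrite eqn_leq m0 andbT -(leq_pmul2l (isT : 0 < 2)).
  have sz5 : size ms = 5.
    by rewrite -hE; elim: (ms) ms1 => //= m ms' IH /andP[/eqP-> /IH->].
  by move/all_pred1P: ms1 => ->; rewrite sz5; vm_compute.
have e : sumn [seq n - t.1 | t <- sp] + sumn [seq n - m | m <- ms] = 2 * n.
  have n2 : 1 < n.
    move: spL fsp; rewrite inE => /predU1P[->|/mapP[t tP ->]] /= /andP[/andP[+ _] _].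
      by rewrite /=; lia.
    by move: tP; rewrite !inE => /or4P[] /eqP-> /=; lia.
  have w1 : 0 < sumn (map kind_weight sp).
    move: spL; rewrite inE => /predU1P[->//|/mapP[t tP ->]].
    by rewrite /= /kind_weight; case: ifP.
  by clear -wL le_h n2 w1; nia.
have [n18 sz3] := solution_bound spL fsp fms e.
by apply: bounded_search => //; rewrite fsp.
Qed.

(** * Between quivers and symbols *)

Lemma star_structure_perm (Q : quiver) (v : Q) legs legs' :
  perm_eq legs legs' -> star_structure v legs -> star_structure v legs'.
Proof.
move=> pl [pV pE]; split.
  apply: perm_trans pV; rewrite perm_cons perm_sym.
  exact: perm_flatten.
by apply: perm_trans pE _; apply/perm_flatten/perm_map.
Qed.

Lemma star_structure_filter (Q : quiver) (v : Q) legs :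
  star_structure v legs -> star_structure v [seq l <- legs | l != [::]].
Proof.
have flt (T : Type) (F : seq Q -> seq T) : F [::] = [::] ->
    flatten (map F legs) = flatten (map F [seq l <- legs | l != [::]]).
  by move=> F0; elim: legs => [|[|x l] legs IHl] //=; rewrite ?F0 IHl.
case=> pV pE; split.
  by have := flt _ id erefl; rewrite !map_id => <-.
by rewrite -flt.
Qed.

Lemma p2_star_iso (Q : quiver) (alpha : dimvec Q) s :
  iso_reorient alpha (star_dimvec s) -> p2_star alpha ->
  star_convex s /\ star_weight s = 2.
Proof.
case=> f [g [bf bg fg fa]] [_ [_ _ neg] _ p2].
have fi i : intvec (star_dimvec s) (f i) = intvec alpha i by rewrite /intvec fa.
have cvx : star_convex s.
  apply/star_convexP => i; case: (bf) => f' fK f'K; rewrite -[i]f'K.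
  rewrite (sym_form_iso bf bg fg fi (fun j => coordvec_inj _ _ (bij_inj bf))).
  exact: neg.
split=> //; have := star_weightE cvx.
rewrite pfun_sym_form (sym_form_iso bf bg fg fi fi) -pfun_sym_form p2.
by lia.
Qed.

Lemma star_shaped_star_quiver s : star_shaped (star_quiver s).
Proof.
pose lv (i : 'I_(size s.2)) (j : 'I_(size (nth [::] s.2 i))) : leg_vertex s :=
  existT _ i j.
pose leg i : seq (star_quiver s) :=
  [seq Some (lv i j) | j <- enum 'I_(size (nth [::] s.2 i))].
have enumE : enum (leg_vertex s) =
    flatten [seq map (lv i) (enum 'I_(size (nth [::] s.2 i)))
            | i <- enum 'I_(size s.2)].
  rewrite enumT unlock /= /tag_enum -enumT.
  by congr flatten; apply: eq_map => i; rewrite -enumT.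
exists None, [seq leg i | i <- enum 'I_(size s.2)]; split.
  rewrite (_ : enum _ = None :: map Some (enum (leg_vertex s))); last exact: enum_option.
  rewrite perm_cons enumE map_flatten -map_comp.
  rewrite [X in perm_eq _ (flatten X)](_ : _ = map leg (enum 'I_(size s.2))) //.
  by apply: eq_map => i /=; rewrite -map_comp.
rewrite [enum _]enumE map_flatten.
suff -> : forall e, map (map (fun a : arrow (star_quiver s) => [set ahead a; atail a]))
    [seq map (lv i) (enum 'I_(size (nth [::] s.2 i))) | i <- e] =
    [seq pairmap (fun x y : star_quiver s => [set x; y]) None l | l <- map leg e] by [].
elim=> //= i e ->; congr (_ :: _); apply: (@eq_from_nth _ set0).
  by rewrite size_pairmap !size_map.
move=> j; rewrite size_map size_map => lt_j.
have legE (o : 'I_(size (nth [::] s.2 i))) :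
    nth (None : star_quiver s) (leg i) o = Some (lv i o).
  by rewrite (nth_map o) ?size_enum_ord // nth_ord_enum.
have lt_o : j < size (nth [::] s.2 i) by rewrite size_enum_ord in lt_j.
pose o := Ordinal lt_o.
rewrite (nth_pairmap None); last by rewrite size_map size_enum_ord.
rewrite -[j]/(o : nat).
have set2E (x y x' y' : star_quiver s) : x = x' -> y = y' -> [set x; y] = [set x'; y'].
  by move=> -> ->.
have lvE : nth (lv i o) [seq lv i j | j <- enum 'I_(size (nth [::] s.2 i))] o = lv i o.
  by rewrite (nth_map o) ?size_enum_ord // nth_ord_enum.
rewrite (nth_map (lv i o)) /=; last by rewrite size_map size_enum_ord.
apply: set2E; last exact: etrans (f_equal Some lvE) (esym (legE o)).
transitivity (leg_prev (lv i o)); first exact: f_equal lvE.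
rewrite /leg_prev /=; case: (j) lt_o @o {lvE lt_j} => // k lt_k o /=.
exact/esym/(legE (ord_down o)).
Qed.

Lemma connected_support_star s :
  (forall x, 0 < star_dimvec s x) -> connected_support (star_dimvec s).
Proof.
move=> pos.
have sadj y : supp_adj (star_dimvec s) (leg_prev y) (Some y : star_quiver s).
  have nz x : star_dimvec s x != 0 by rewrite -lt0n pos.
  rewrite /supp_adj !inE !nz /=.
  by apply/existsP; exists y; rewrite /=.
have conn d (y : leg_vertex s) : leg_depth y = d ->
    connect (supp_adj (star_dimvec s)) None (Some y : star_quiver s).
  elim: d y => [|d IHd] y yd; apply: connect_trans (connect1 (sadj y)).
    by rewrite /leg_prev -[X in X == _]/(leg_depth y) yd /= connect0.
  rewrite /leg_prev -[X in X == _]/(leg_depth y) yd /=.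
  by apply: IHd; rewrite {1}/leg_depth /= -/(leg_depth y) yd.
have connN x : connect (supp_adj (star_dimvec s)) None x.
  by case: x => [y|]; [apply: conn erefl|apply: connect0].
have sym : symmetric (supp_adj (star_dimvec s)).
  move=> x y; rewrite /supp_adj andbCA; congr [&& _, _ & _].
  by apply: eq_existsb => a; rewrite [[set x; y]]setUC.
move=> x y _ _; apply: connect_trans (connN y).
by rewrite (sym_connect_sym sym) connN.
Qed.

Lemma star_dimvec_gt0 s x :
  all (leq 1) (s.1 :: flatten s.2) -> 0 < star_dimvec s x.
Proof.
case: x => [[i j]|] /= /andP[n0 /allP pos] //=; apply: pos.
apply/flattenP; exists (nth [::] s.2 i); first by rewrite mem_nth.
by rewrite mem_nth.
Qed.

Lemma p2_star_symbol s :
  all (leq 1) (s.1 :: flatten s.2) -> star_convex s -> star_weight s = 2 ->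
  p2_star (star_dimvec s).
Proof.
move=> pos cvx w2; have pos' := star_dimvec_gt0 _ pos.
split=> //; first exact: star_shaped_star_quiver.
  split; [|exact: connected_support_star|exact/star_convexP].
  by exists None; rewrite -lt0n.
by have := star_weightE cvx; rewrite w2; lia.
Qed.

Lemma dims_star_dimvec s :
  [seq star_dimvec s x | x <- enum (star_quiver s)] = s.1 :: flatten s.2.
Proof.
rewrite (_ : enum _ = None :: map Some (enum (leg_vertex s))); last exact: enum_option.
rewrite /= -map_comp; congr (_ :: _).
rewrite -[LHS]/(map (fun y : leg_vertex s => nth 0 (nth [::] s.2 (leg_index y)) (leg_depth y)) _).
rewrite (enum_leg_vertex_map s (fun i => nth 0 (nth [::] s.2 i))).
rewrite -[in RHS](mkseq_nth [::] s.2); congr flatten.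
by apply: eq_map => i; apply: mkseq_nth.
Qed.

Lemma iso_perm_dims (Q Q' : quiver) (alpha : dimvec Q) (alpha' : dimvec Q') :
  iso_reorient alpha alpha' ->
  perm_eq (map alpha (enum Q)) (map alpha' (enum Q')).
Proof.
case=> f [g [bf _ _ fa]]; rewrite -(eq_map fa) map_comp; apply: perm_map.
have [f' fK f'K] := bf.
apply: uniq_perm; rewrite ?(map_inj_uniq (bij_inj bf)) ?enum_uniq // => x.
by rewrite -[x]f'K (mem_map (bij_inj bf)) !mem_enum.
Qed.

Theorem theorem5p1 :
  [/\ forall k : 'I_13, p2_star (star_dimvec (tnth star_table k)),
      forall k l : 'I_13,
        iso_reorient (star_dimvec (tnth star_table k))
                     (star_dimvec (tnth star_table l)) -> k = l
    & forall (Q : quiver) (alpha : dimvec Q), p2_star alpha ->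
        exists k : 'I_13,
          iso_reorient alpha (star_dimvec (tnth star_table k))].
Proof.
split.
- move=> k; have : all (fun s : star_symbol =>
      [&& all (leq 1) (s.1 :: flatten s.2), star_convex s & star_weight s == 2])
      star_table by vm_compute.
  by move/all_tnthP/(_ k)/and3P=> [pos cvx /eqP]; apply: p2_star_symbol.
- pose dims i := let s := nth (0, [::]) star_table i in s.1 :: flatten s.2.
  have chk : all (fun i => all (fun j =>
      perm_eq (dims i) (dims j) ==> (i == j)) (iota 0 13)) (iota 0 13).
    by vm_compute.
  move=> k l /iso_perm_dims; rewrite !dims_star_dimvec !(tnth_nth (0, [::])) => pkl.
  have kP (i : 'I_13) : (i : nat) \in iota 0 13 by rewrite mem_iota /=.
  have := allP (allP chk k (kP k)) l (kP l).
  by rewrite /dims pkl => /eqP/val_inj.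
move=> Q alpha p2; have [[v [legs0 st0]] _ pos _] := p2.
(* A star structure may have empty legs, the symbols of the table do not. *)
have := star_structure_filter (st0 : star_structure v legs0).
set legs := filter _ _ => st.
have [cvx w2] := p2_star_iso (symbol_iso alpha st) p2.
have /hasP[s sT /andP[/eqP s1 s2]] : in_star_table (alpha v) (map (map alpha) legs).
  apply: classification => //.
    by apply/allP => _ /mapP[l _ ->]; apply/allP => _ /mapP[x _ ->]; apply: pos.
  apply/mapP => -[l]; rewrite mem_filter => /andP[l0 _] /esym/eqP.
  by rewrite -size_eq0 size_map size_eq0 (negPf l0).
have [legs' pl' s2E] := perm_map_lift s2.
have st' := star_structure_perm (etrans (perm_sym _ _) pl') st.
have /tnthP[k sE] := sT; exists k; rewrite -sE.
have -> : s = symbol_of alpha v legs' by rewrite /symbol_of -s1 -s2E; case: (s).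
exact: symbol_iso.
Qed.
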